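(* Let $n\ge 2$ and let $\mathfrak{h}^3\oplus\mathbb{R}^{2n-3}$ be the real Lie algebra with basis $\{e_1,\ldots,e_{2n}\}$ and bracket relation $[e_1,e_2]=e_{2n}$. There exists a unique symplectic structure on $\mathfrak{h}^3\oplus\mathbb{R}^{2n-3}$ up to automorphism and scale. In fact, $\omega\in\Omega(\mathfrak{h}^3\oplus\mathbb{R}^{2n-3})$ satisfies $d\omega=0$ if and only if there exist $t>0$ and a symplectic basis $\{x_1,\ldots,x_{2n}\}\subset\mathfrak{h}^3\oplus\mathbb{R}^{2n-3}$ with respect to $t\omega$ whose bracket relations are given by $$[x_1,x_2]=x_{n+1}.$$
   Context: When bracket relations are given in a basis, all brackets of basis vectors not determined by the listed ones through antisymmetry are zero. $\mathfrak{h}^3\oplus\mathbb{R}^{2n-3}$ is the direct sum of the 3-dimensional Heisenberg Lie algebra and an abelian Lie algebra. $\Omega(\mathfrak{g})$ denotes the set of nondegenerate alternating bilinear forms ($2$-forms) on the vector space $\mathfrak{g}$. For $\omega\in\Omega(\mathfrak{g})$, $d\omega(x,y,z):=\omega(x,[y,z])+\omega(z,[x,y])+\omega(y,[z,x])$; a symplectic structure (symplectic form) on $\mathfrak{g}$ is an $\omega\in\Omega(\mathfrak{g})$ with $d\omega=0$. Two forms $\omega_1,\omega_2\in\Omega(\mathfrak{g})$ are equivalent up to automorphism and scale if there exist a Lie algebra automorphism $\phi\in\mathrm{Aut}(\mathfrak{g})$ and a constant $c\ne0$ such that $c\cdot\phi^*\omega_1=\omega_2$. A basis $\{x_1,\ldots,x_{2n}\}$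 is symplectic with respect to a $2$-form $\omega$ if for all $i<j$ one has $\omega(x_i,x_j)=1$ when $j=i+n$ and $\omega(x_i,x_j)=0$ otherwise. *)

(* Defs.v *)
From HB Require Import structures.
From mathcomp Require Import all_boot all_order all_algebra.
From mathcomp Require Import zify ring.

Set Implicit Arguments.
Unset Strict Implicit.
Unset Printing Implicit Defensive.

Import GRing.Theory.
Local Open Scope ring_scope.

Record lieAlgebra (R : fieldType) := LieAlgebra {
  lie_space :> vectType R;
  lie : {bilinear lie_space -> lie_space -> lie_space};
  lie_alternating : forall x, lie x x = 0;
  lie_jacobi : forall x y z,
    lie x (lie y z) + lie y (lie z x) + lie z (lie x y) = 0 }.

(* Tuples are indexed from 0: [x`_0], [x`_1] and [x`_k] are the mathematical
   x_1, x_2 and x_{k+1}.  The brackets with i >= j are determined by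
   antisymmetry. *)
Definition single_bracket_relation (R : fieldType) (g : lieAlgebra R) (m : nat)
    (x : m.-tuple g) (k : nat) : Prop :=
  forall i j : 'I_m, (i < j)%N ->
    lie g x`_i x`_j =
    if (i == 0%N :> nat) && (j == 1%N :> nat) then x`_k else 0.

(* The Lie algebra h^3 (+) R^(2n-3): [e_1, e_2] = e_{2n}. *)
Definition heisenberg_sum_basis (R : fieldType) (g : lieAlgebra R) (n : nat)
    (e : (2 * n)%N.-tuple g) : Prop :=
  basis_of fullv e /\ single_bracket_relation e (2 * n).-1.

Section Forms.
Variables (R : fieldType) (g : lieAlgebra R).

(* The set Omega(g). *)
Definition nondeg_two_form (w : {biscalar g}) : Prop :=
  (forall x, w x x = 0) /\ (forall x, (forall y, w x y = 0) -> x = 0).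

Definition d_form (w : {biscalar g}) (x y z : g) : R :=
  w x (lie g y z) + w z (lie g x y) + w y (lie g z x).

Definition closed_form (w : {biscalar g}) : Prop :=
  forall x y z, d_form w x y z = 0.

Definition symplectic_form (w : {biscalar g}) : Prop :=
  nondeg_two_form w /\ closed_form w.

Definition lie_automorphism (phi : 'End(g)) : Prop :=
  bijective phi /\ forall x y, phi (lie g x y) = lie g (phi x) (phi y).

Definition equiv_aut_scale (w1 w2 : {biscalar g}) : Prop :=
  exists (phi : 'End(g)) (c : R), [/\ lie_automorphism phi, c != 0
    & forall x y, c * w1 (phi x) (phi y) = w2 x y].

Definition symplectic_basis (n : nat) (w : g -> g -> R)
    (x : (2 * n)%N.-tuple g) : Prop :=
  basis_of fullv x /\
  forall i j : 'I_(2 * n), (i < j)%N ->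
    w x`_i x`_j = (if j == (i + n)%N :> nat then 1 else 0).

End Forms.

(* Existence of a Lie algebra with a basis as in [heisenberg_sum_basis]. *)
Section Model.
Variables (R : fieldType) (m : nat) (a b c : 'I_m).

(* [e_a, e_b] = e_c in the standard basis *)
Definition heis_bracket (x y : 'rV[R]_m) : 'rV[R]_m :=
  (x 0 a * y 0 b - x 0 b * y 0 a) *: delta_mx 0 c.

Fact heis_bracket_bilinear : bilinear_for
  (GRing.Scale.Law.clone _ _ *:%R _) (GRing.Scale.Law.clone _ _ *:%R _)
  heis_bracket.
Proof.
split=> [u'|u] k x y /=; rewrite /heis_bracket !mxE scalerA -scalerDl;
  congr (_ *: _); ring.
Qed.

HB.instance Definition _ :=
  bilinear_isBilinear.Build R 'rV[R]_m 'rV[R]_m 'rV[R]_m _ _ heis_bracket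
    heis_bracket_bilinear.

Hypotheses (ca : c != a) (cb : c != b).

Fact heis_bracket_alternating x : heis_bracket x x = 0.
Proof. by rewrite /heis_bracket mulrC subrr scale0r. Qed.

Fact heis_bracket_nilp x y z : heis_bracket x (heis_bracket y z) = 0.
Proof.
rewrite {1}/heis_bracket !mxE eqxx /= ![_ == c]eq_sym (negPf ca) (negPf cb).
by rewrite !mulr0 subrr scale0r.
Qed.

Fact heis_bracket_jacobi x y z :
  heis_bracket x (heis_bracket y z) + heis_bracket y (heis_bracket z x)
  + heis_bracket z (heis_bracket x y) = 0.
Proof. by rewrite !heis_bracket_nilp !addr0. Qed.

Definition heis_model : lieAlgebra R :=
  @LieAlgebra R 'rV[R]_m heis_bracket heis_bracket_alternating
    heis_bracket_jacobi.

End Model.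

Fact heisenberg_sum_exists (R : fieldType) (n : nat) : (2 <= n)%N ->
  exists (g : lieAlgebra R) (e : (2 * n)%N.-tuple g), heisenberg_sum_basis e.
Proof.
move=> n2; have h0 : (0 < 2 * n)%N by lia.
have h1 : (1 < 2 * n)%N by lia.
have hc : ((2 * n).-1 < 2 * n)%N by lia.
pose a := Ordinal h0; pose b := Ordinal h1; pose c := Ordinal hc.
have ca : c != a by rewrite -val_eqE /=; lia.
have cb : c != b by rewrite -val_eqE /=; lia.
pose e : (2 * n)%N.-tuple 'rV[R]_(2 * n) := [tuple delta_mx 0 i | i < 2 * n].
have eE (i : 'I_(2 * n)) : e`_i = delta_mx 0 i.
  by rewrite -tnth_nth tnth_mktuple.
exists (heis_model R ca cb), e; split.
  rewrite basisEdim; apply/andP; split; last first.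
    by rewrite size_tuple dimvf dim_matrix mul1r.
  apply/subvP => v _; rewrite (row_sum_delta v); apply: memv_suml => i _.
  by apply/memvZ/memv_span; rewrite -eE mem_nth // size_tuple.
move=> i j ij; rewrite !eE /= /heis_bracket !mxE eqxx /=.
rewrite -[(2 * n).-1]/(val c) eE -!val_eqE /=.
case: i ij => i /= hi; case: j => j /= hj ij; rewrite [0%N == i]eq_sym.
rewrite [1%N == j]eq_sym [0%N == j]eq_sym.
have /negPf -> : j != 0%N by lia.
by rewrite mulr0 subr0; case: eqP; case: eqP => *;
  rewrite ?mulr1 ?mulr0 ?mul0r ?scale1r ?scale0r.
Qed.

(* Main.v *)
Require Import Defs.
From HB Require Import structures.
From mathcomp Require Import all_boot all_order all_algebra.
From mathcomp Require Import reals zify ring.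

Import Order.TTheory GRing.Theory Num.Theory.
Local Open Scope ring_scope.

Set Implicit Arguments.
Unset Strict Implicit.
Unset Printing Implicit Defensive.

(* Write the bracket as [u, v] = (a(u) b(v) - a(v) b(u)) z with a, b coordinate
   functionals and z central.  A form w is closed iff the functional w(-, z) is
   a combination A a + B b.  If moreover w is nondegenerate, pick x_1 with
   w(x_1, z) = 1 and put x_2 = A e_2 - B e_1, corrected by a multiple of z so
   that w(x_1, x_2) = 0: then [x_1, x_2] = z =: x_{n+1}.  Let x_{n+2} be the
   vector with w(u, x_{n+2}) z = [x_1, u] for all u.  Then x_1, x_2, x_{n+1},
   x_{n+2} are two symplectic pairs, and every vector w-orthogonal to both
   x_{n+1} and x_{n+2} is central, so any completion to a symplectic basis has
   the required brackets; the scale t = 1 suffices.  Mapping one such basis to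
   another gives uniqueness. *)

(** * Symplectic Gram-Schmidt: completing partial families of symplectic pairs *)

Lemma alternating_skew (F : nzRingType) (V : lmodType F) (W : zmodType)
    (s s' : F -> W -> W) (w : {bilinear V -> V -> W | s & s'})
    (alt : forall x, w x x = 0) (x y : V) : w x y = - w y x.
Proof.
apply/eqP; rewrite -addr_eq0; apply/eqP; have := alt (x + y).
by rewrite linearDl !linearDr !alt add0r addr0.
Qed.

(** Families on [nat] constrained only below [k], so that adding a pair is a pointwise update at
    [k]. *)
Definition symplectic_pairs (F : fieldType) (V : vectType F) (w : {biscalar V})
    (k : nat) (p q : nat -> V) : Prop :=
  forall i j, (i < k)%N -> (j < k)%N ->
    [/\ w (p i) (p j) = 0, w (q i) (q j) = 0 & w (p i) (q j) = (i == j)%:R].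

(** The [w]-orthogonal projection onto the span of the pairs; the minus sign comes from
    [w (q i) (p i) = -1]. *)
Definition symplectic_proj (F : fieldType) (V : vectType F) (w : {biscalar V})
    (k : nat) (p q : nat -> V) (u : V) : V :=
  \sum_(i < k) (w u (q i) *: p i - w u (p i) *: q i).

Lemma symplectic_proj_pairing (F : fieldType) (V : vectType F)
    (w : {biscalar V}) (alt : forall x, w x x = 0) (k : nat) (p q : nat -> V)
    (pq : symplectic_pairs w k p q) (u : V) (j : nat) : (j < k)%N ->
  w (symplectic_proj w k p q u) (p j) = w u (p j) /\
  w (symplectic_proj w k p q u) (q j) = w u (q j).
Proof.
move=> jk; have sk := alternating_skew alt.
rewrite /symplectic_proj !linear_sumlz.
split; rewrite (bigD1 (Ordinal jk)) //= big1 ?addr0 => [|i].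
- rewrite linearBl !linearZl_LR /= (sk (q j)).
  by case: (pq j j jk jk) => -> _ ->; rewrite eqxx mulr0 mulrN1 opprK add0r.
- rewrite -val_eqE /= => /negPf ij.
  have [pp _ _] := pq i j (ltn_ord i) jk.
  have [_ _ qp] := pq j i jk (ltn_ord i).
  rewrite linearBl !linearZl_LR /= (sk (q i)) qp pp.
  by rewrite eq_sym ij oppr0 !mulr0 subr0.
- rewrite linearBl !linearZl_LR /=.
  by case: (pq j j jk jk) => _ -> ->; rewrite eqxx mulr0 mulr1 subr0.
- rewrite -val_eqE /= => /negPf ij; have [_ qq pq'] := pq i j (ltn_ord i) jk.
  by rewrite linearBl !linearZl_LR /= qq pq' ij !mulr0 subr0.
Qed.

(** By dimension, some vector lies outside the span of the [k] pairs. Its residue modulo the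
    projection is nonzero and orthogonal to all pairs; nondegeneracy gives it a partner, which is
    then made orthogonal to the pairs and rescaled. *)
Lemma symplectic_pairs_extend (F : fieldType) (V : vectType F)
    (w : {biscalar V}) (alt : forall x, w x x = 0)
    (nondeg : forall x, (forall y, w x y = 0) -> x = 0) (k : nat)
    (p q : nat -> V) (pq : symplectic_pairs w k p q) :
  (2 * k < \dim {:V})%N ->
  exists u v, symplectic_pairs w k.+1
    [eta p with k |-> u] [eta q with k |-> v].
Proof.
move=> dimV; pose P := symplectic_proj w k p q.
pose res u := u - P u.
have resp u j : (j < k)%N -> w (res u) (p j) = 0.
  move=> jk; rewrite linearBl.
  by rewrite (symplectic_proj_pairing alt pq _ jk).1 subrr.
have resq u j : (j < k)%N -> w (res u) (q j) = 0.
  move=> jk; rewrite linearBl.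
  by rewrite (symplectic_proj_pairing alt pq _ jk).2 subrr.
have [u u0] : exists u, res u != 0.
  pose U := <<mkseq p k ++ mkseq q k>>%VS.
  have dimU : (\dim U < \dim {:V})%N.
    by apply: leq_ltn_trans (dim_span _) _; rewrite size_cat !size_mkseq; lia.
  have [u /negP uU] : exists u, ~~ (u \in U).
    have : ~~ ({:V} <= U)%VS by apply/negP => /dimvS; rewrite leqNgt dimU.
    by case/subvPn => u _; exists u.
  exists u; apply/eqP => /eqP; rewrite subr_eq0 => /eqP uE; apply: uU.
  rewrite uE; apply: memv_suml => i _; rewrite memvB // memvZ // memv_span //.
    by rewrite mem_cat; apply/orP; left; apply: map_f; rewrite mem_iota /=.
  by rewrite mem_cat; apply/orP; right; apply: map_f; rewrite mem_iota /=.
have [y uy] : exists y, w (res u) y != 0.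
  (* Nondegeneracy is only an implication; searching a finite basis, where the test is decidable,
     yields an actual witness. *)
  have [v] : exists v, v \in vbasis {:V} /\ w (res u) v != 0.
    have [/hasP[v]|] := boolP (has (fun v => w (res u) v != 0) (vbasis {:V})).
      by exists v.
    move=> /hasPn h; case/eqP: u0; apply: nondeg => y.
    rewrite (coord_vbasis (memvf y)) linear_sumr big1 // => i _.
    rewrite linearZr_LR /= (eqP (negPn (h _ _))) ?mulr0 //.
    by rewrite mem_nth // size_tuple.
  by case=> _; exists v.
(* Hence replacing [y] by [res y] leaves its pairing with [res u] unchanged. *)
have uP x : w (res u) (P x) = 0.
  rewrite linear_sumr big1 // => i _.
  by rewrite linearBr !linearZr_LR /= resp // resq // !mulr0 subr0.
pose v := (w (res u) y)^-1 *: res y.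
have uv : w (res u) v = 1.
  by rewrite linearZr_LR /= linearBr uP subr0 mulVf.
exists (res u), v => i j ik jk.
have sk := alternating_skew alt.
have vp l : (l < k)%N -> w v (p l) = 0.
  by move=> lk; rewrite linearZl_LR /= resp // mulr0.
have vq l : (l < k)%N -> w v (q l) = 0.
  by move=> lk; rewrite linearZl_LR /= resq // mulr0.
rewrite /= [i == k]eq_sym [j == k]eq_sym.
have [iE|ik'] := eqVneq k i; have [jE|jk'] := eqVneq k j.
- by rewrite -iE -jE !alt uv eqxx.
- have jlt : (j < k)%N by lia.
  by rewrite -iE resp // resq // vq // (negPf jk').
- have ilt : (i < k)%N by lia.
  rewrite -jE (sk _ (res u)) (sk _ v) (sk _ v) resp // vq // vp //.
  by rewrite eq_sym (negPf ik') !oppr0.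
- by apply: pq; lia.
Qed.

(** Pairs are added one at a time. The first [k] are kept, so that bracket information attached to
    them survives. *)
Lemma symplectic_pairs_complete (F : fieldType) (V : vectType F)
    (w : {biscalar V}) (alt : forall x, w x x = 0)
    (nondeg : forall x, (forall y, w x y = 0) -> x = 0)
    (k n : nat) (p q : nat -> V) (pq : symplectic_pairs w k p q) :
  (k <= n)%N -> (2 * n <= \dim {:V})%N ->
  exists p' q', (forall i, (i < k)%N -> p' i = p i /\ q' i = q i) /\
    symplectic_pairs w n p' q'.
Proof.
move=> + dimV; elim: n dimV => [|n IHn] dimV kn.
  by exists p, q; split=> //; move: kn pq; rewrite leqn0 => /eqP->.
move: kn; rewrite leq_eqVlt => /orP[/eqP kE|kn].
  by exists p, q; rewrite -kE.
have [||p' [q' [agree pq']]] := IHn; [lia|lia|].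
have [|u [v ext]] := symplectic_pairs_extend alt nondeg pq'.
  by lia.
exists [eta p' with n |-> u], [eta q' with n |-> v]; split=> // i ik /=.
by rewrite ltn_eqF; [exact: agree|exact: leq_trans ik kn].
Qed.

(** * From symplectic pairs to symplectic bases *)

(** All [p]'s precede all [q]'s, so that partners sit at distance [n]. *)
Definition tuple_of_pairs (T : Type) (n : nat) (p q : nat -> T) :
    (2 * n)%N.-tuple T :=
  [tuple if (i < n)%N then p i else q (i - n)%N | i < 2 * n].

Lemma nth_tuple_of_pairs (T : Type) (x0 : T) (n : nat) (p q : nat -> T)
    (i : nat) : (i < 2 * n)%N ->
  nth x0 (tuple_of_pairs n p q) i = if (i < n)%N then p i else q (i - n)%N.
Proof.
by move=> lt_i; rewrite -[i]/(val (Ordinal lt_i)) -tnth_nth tnth_mktuple.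
Qed.

(** For freeness, pair a vanishing combination with the partner of each vector: exactly one
    coefficient survives. *)
Lemma symplectic_pairs_basis (F : fieldType) (g : lieAlgebra F)
    (w : {biscalar g}) (alt : forall x, w x x = 0) (n : nat) (p q : nat -> g) :
  \dim {:g} = (2 * n)%N -> symplectic_pairs w n p q ->
  symplectic_basis w (tuple_of_pairs n p q).
Proof.
move=> dimg pq; split; last first.
  move=> i j lt_ij; have [lti ltj] := (ltn_ord i, ltn_ord j).
  rewrite !nth_tuple_of_pairs //; have [ltjn|lejn] := ltnP j n.
    have lt_in : (i < n)%N by lia.
    rewrite lt_in; have [-> _ _] := pq _ _ lt_in ltjn.
    by rewrite (_ : (_ == _) = false) //; lia.
  have ltjn : (j - n < n)%N by lia.
  have [ltin|lein] := ltnP i n.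
    have [_ _ ->] := pq _ _ ltin ltjn.
    rewrite (_ : (_ == _) = (j == i + n :> nat)%N); first by case: eqP.
    by lia.
  have ltin : (i - n < n)%N by lia.
  have [_ -> _] := pq _ _ ltin ltjn.
  by rewrite (_ : (_ == _) = false) //; lia.
rewrite basisEfree subvf size_tuple dimg leqnn !andbT.
apply/freeP => k k0 j; have ltj := ltn_ord j.
have [ltjn|lejn] := ltnP j n.
  have ltj' : (j + n < 2 * n)%N by lia.
  have := linear0l w (q j); rewrite -k0 linear_sumlz (bigD1 j) //= big1.
    rewrite addr0 linearZl_LR /= nth_tuple_of_pairs // ltjn.
    by have [_ _ ->] := pq _ _ ltjn ltjn; rewrite eqxx mulr1.
  move=> i; rewrite -val_eqE /= => ij.
  rewrite linearZl_LR nth_tuple_of_pairs //=.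
  have [ltin|lein] := ltnP i n.
    by have [_ _ ->] := pq _ _ ltin ltjn; rewrite (negPf ij) mulr0.
  have ltin : (i - n < n)%N by have := ltn_ord i; lia.
  by have [_ -> _] := pq _ _ ltin ltjn; rewrite mulr0.
have ltjn : (j - n < n)%N by lia.
have := linear0r w (p (j - n)%N); rewrite -k0 linear_sumr (bigD1 j) //= big1.
  rewrite addr0 linearZr_LR /= nth_tuple_of_pairs // ltnNge lejn.
  by have [_ _ ->] := pq _ _ ltjn ltjn; rewrite eqxx mulr1.
move=> i; rewrite -val_eqE /= => ij; rewrite linearZr_LR nth_tuple_of_pairs //=.
have [ltin|lein] := ltnP i n.
  by have [-> _ _] := pq _ _ ltjn ltin; rewrite mulr0.
have ltin : (i - n < n)%N by have := ltn_ord i; lia.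
have [_ _ ->] := pq _ _ ltjn ltin.
by rewrite (_ : (_ == _) = false) ?mulr0 //; lia.
Qed.

(** * Representing functionals by a nondegenerate form *)

(** The Gram matrix [G] is invertible, since a row in its left kernel gives a vector in the radical
    of [w]; it remains to solve a linear system. *)
Lemma nondeg_represent (F : fieldType) (V : vectType F) (w : {biscalar V})
    (nondeg : forall x, (forall y, w x y = 0) -> x = 0)
    (m : nat) (e : m.-tuple V) (be : basis_of fullv e) (c : 'I_m -> F) :
  exists v, forall i : 'I_m, w e`_i v = c i.
Proof.
pose G := \matrix_(i < m, j < m) w e`_i e`_j.
have uG : G \in unitmx.
  rewrite -row_free_unit -kermx_eq0; apply/rowV0P => r /sub_kermxP rG.
  pose u := \sum_i r 0 i *: e`_i.
  have u0 : u = 0.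
    apply: nondeg => y; rewrite (coord_basis be (memvf y)) linear_sumr.
    apply: big1 => j _; rewrite linearZr_LR /= linear_sumlz.
    have /rowP /(_ j) := rG; rewrite !mxE => h.
    rewrite (eq_bigr (fun i => r 0 i * G i j)) ?h ?mulr0 // => i _.
    by rewrite mxE linearZl_LR.
  apply/rowP => i; rewrite mxE.
  by have /freeP /(_ (r 0) u0) := basis_free be.
pose d := invmx G *m \col_i c i.
exists (\sum_j d j 0 *: e`_j) => i.
have /colP /(_ i) : G *m d = \col_i c i by rewrite mulKVmx.
rewrite [RHS]mxE => <-; rewrite mxE linear_sumr; apply: eq_bigr => j _.
by rewrite linearZr_LR /= [G i j]mxE mulrC.
Qed.

Lemma nondeg_represent_coord (F : fieldType) (V : vectType F)
    (w : {biscalar V})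
    (nondeg : forall x, (forall y, w x y = 0) -> x = 0)
    (m : nat) (e : m.-tuple V) (be : basis_of fullv e) (i : 'I_m) :
  exists v, forall u, w u v = coord e i u.
Proof.
have [v vE] := nondeg_represent nondeg be (fun j => (j == i)%:R).
exists v => u; rewrite {1}(coord_basis be (memvf u)) linear_sumlz.
rewrite (bigD1 i) //= big1 ?addr0 => [|j /negPf ji];
  rewrite linearZl_LR /= vE ?eqxx ?mulr1 //.
by rewrite ji mulr0.
Qed.

(** * The bracket in coordinates, and closed forms *)

(** The target index [k] is left free to serve both the given basis, with [k = (2 * n).-1], and the
    normal form, with [k = n]. *)
Lemma lie_coordE (F : fieldType) (g : lieAlgebra F) (m k : nat)
    (x : m.-tuple g) (bx : basis_of fullv x) (i0 i1 : 'I_m) (u v : g) :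
  i0 = 0%N :> nat -> i1 = 1%N :> nat -> single_bracket_relation x k ->
  lie g u v = (coord x i0 u * coord x i1 v - coord x i0 v * coord x i1 u)
                *: x`_k.
Proof.
move=> i0E i1E rel.
have skew := alternating_skew (@lie_alternating F g).
have i10 : i1 != i0 by rewrite -val_eqE /= i0E i1E.
have lie0 y : lie g x`_i0 y = coord x i1 y *: x`_k.
  rewrite {1}(coord_basis bx (memvf y)) linear_sumr (bigD1 i1) //=.
  rewrite big1 ?addr0 => [|j]; rewrite linearZr_LR /=.
    by rewrite rel ?i0E ?i1E.
  rewrite -val_eqE /= i1E => /negPf j1; have [j0|jp] := posnP j.
    by rewrite j0 i0E lie_alternating scaler0.
  by rewrite rel ?i0E //= j1 scaler0.
have lie1 y : lie g x`_i1 y = - coord x i0 y *: x`_k.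
  rewrite {1}(coord_basis bx (memvf y)) linear_sumr (bigD1 i0) //=.
  rewrite big1 ?addr0 => [|j]; rewrite linearZr_LR /=.
    by rewrite skew rel ?i0E ?i1E // scalerN scaleNr.
  rewrite -val_eqE /= i0E => /negPf j0; have [j1|jn1] := eqVneq (j : nat) 1%N.
    by rewrite j1 i1E lie_alternating scaler0.
  by rewrite rel ?i1E ?scaler0 //; lia.
rewrite {1}(coord_basis bx (memvf u)) linear_sumlz (bigD1 i0) //=.
rewrite (bigD1 i1) //= big1 ?addr0 => [|i /andP[]].
  by rewrite !linearZl_LR /= lie0 lie1 !scalerA -scalerDl; congr (_ *: _); ring.
rewrite -!val_eqE /= i0E i1E => /negPf n0 /negPf n1.
rewrite linearZl_LR /= (coord_basis bx (memvf v)) linear_sumr big1 ?scaler0 //.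
move=> j _; rewrite linearZr_LR /=; have [ij|ji|ij] := ltngtP i j.
- by rewrite rel //= n0 scaler0.
- by rewrite skew rel //= n1 andbF oppr0 scaler0.
- by rewrite ij lie_alternating scaler0.
Qed.

(** Here [d_form w x y t] is [c] times the 3 by 3 determinant with rows [a], [a], [b] evaluated at
    [x], [y], [t]. *)
Lemma closed_of_bracket (F : fieldType) (g : lieAlgebra F) (w : {biscalar g})
    (a b : g -> F) (z : g) (c : F) :
  (forall u v, lie g u v = (a u * b v - a v * b u) *: z) ->
  (forall u, w u z = c * a u) -> closed_form w.
Proof.
move=> lieE wz x y t; rewrite /d_form !lieE !linearZr_LR /= !wz; ring.
Qed.

(** * Normal form of a symplectic structure *)

(** The pairs are (x_1, x_{n+1}) and (x_2, x_{n+2}). The last clause tests centrality by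
    orthogonality to the two [q]'s, which holds for all vectors added later. *)
Lemma closed_nondeg_normal_pairs (F : fieldType) (g : lieAlgebra F)
    (m : nat) (e : m.-tuple g) (be : basis_of fullv e)
    (rel : single_bracket_relation e m.-1) (m2 : (2 < m)%N)
    (w : {biscalar g}) :
  symplectic_form w ->
  exists p q : nat -> g, [/\ symplectic_pairs w 2 p q,
    lie g (p 0%N) (p 1%N) = q 0%N
    & forall u, w u (q 0%N) = 0 -> w u (q 1%N) = 0 ->
        forall y, lie g u y = 0].
Proof.
move=> [[alt nondeg] closed]; have sk := alternating_skew alt.
have h0 : (0 < m)%N by lia.
have h1 : (1 < m)%N by lia.
have hz : (m.-1 < m)%N by lia.
pose i0 := Ordinal h0; pose i1 := Ordinal h1; pose iz := Ordinal hz.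
pose a := coord e i0; pose b := coord e i1; pose z := e`_m.-1.
have lieE u v : lie g u v = (a u * b v - a v * b u) *: z.
  exact: lie_coordE.
have fe := basis_free be.
have [a0 b0] : a e`_0 = 1 /\ b e`_0 = 0.
  by split; [exact: (coord_free i0 i0 fe)|exact: (coord_free i0 i1 fe)].
have [a1 b1] : a e`_1 = 0 /\ b e`_1 = 1.
  by split; [exact: (coord_free i1 i0 fe)|exact: (coord_free i1 i1 fe)].
have [az bz] : a z = 0 /\ b z = 0.
  have [n0 n1] : (iz == i0) = false /\ (iz == i1) = false.
    by rewrite -!val_eqE /=; lia.
  split; first by have := coord_free iz i0 fe; rewrite n0.
  by have := coord_free iz i1 fe; rewrite n1.
pose A := w e`_0 z; pose B := w e`_1 z.
(* Closedness evaluated on [u], e_1, e_2. *)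
have beta u : w u z = A * a u + B * b u.
  have := closed u e`_0 e`_1; rewrite /d_form !lieE a0 b0 a1 b1.
  rewrite !linearZr_LR /= -/A -/B => h; apply/eqP; rewrite -subr_eq0.
  by apply/eqP; rewrite -[RHS]h; ring.
have [y1 y1z] : exists y1, w y1 z = 1.
  have z0 : z != 0.
    apply/eqP => z0; have := coord_free iz iz fe.
    by rewrite -[e`_iz]/z z0 linear0 eqxx => /esym/eqP; rewrite oner_eq0.
  (* The last coordinate is 1 on [z], so its representative [v] has [w z v = 1]; skewness turns this
     into [w (- v) z = 1]. *)
  have [v vE] := nondeg_represent_coord nondeg be iz.
  exists (- v); rewrite linearNl sk opprK vE.
  by rewrite -[z]/(e`_iz) coord_free // eqxx.
(* Once [x2] has coordinates [a x2 = - B] and [b x2 = A], this is the coefficient of [z] in the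
   bracket of [y1] and [x2]. *)
have det : A * a y1 + B * b y1 = 1 by rewrite -beta.
have coordB i u v : coord e i (u - v) = coord e i u - coord e i v.
  exact: linearB.
have coordZ i c u : coord e i (c *: u) = c * coord e i u by exact: linearZ.
(* The multiple of [z] makes [w y1 x2] vanish, because [w y1 z = 1], and leaves [a] and [b]
   unchanged. *)
pose x2 := A *: e`_1 - B *: e`_0 - w y1 (A *: e`_1 - B *: e`_0) *: z.
have ax2 : a x2 = - B.
  by rewrite /x2 /a 2!coordB !coordZ -/a a0 a1 az; ring.
have bx2 : b x2 = A.
  by rewrite /x2 /b 2!coordB !coordZ -/b b0 b1 bz; ring.
have [va vaE] := nondeg_represent_coord nondeg be i0.
have [vb vbE] := nondeg_represent_coord nondeg be i1.
pose v := a y1 *: vb - b y1 *: va.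
have vE u : w u v = a y1 * b u - b y1 * a u.
  by rewrite linearBr !linearZr_LR /= vaE vbE.
exists (nth 0 [:: y1; x2]), (nth 0 [:: z; v]); split => /=.
- have y1x2 : w y1 x2 = 0 by rewrite linearBr linearZr_LR /= y1z; ring.
  have zv : w z v = 0 by rewrite vE az bz; ring.
  have y1v : w y1 v = 0 by rewrite vE; ring.
  have x2z : w x2 z = 0 by rewrite beta ax2 bx2; ring.
  have x2v : w x2 v = 1 by rewrite vE ax2 bx2 -det; ring.
  case=> [|[|i]] [|[|j]] //= _ _; rewrite ?alt ?y1x2 ?zv ?y1v ?x2z ?x2v ?y1z //.
  by rewrite [w x2 y1]sk [w v z]sk y1x2 zv oppr0.
- rewrite lieE ax2 bx2 (_ : _ - _ = 1) ?scale1r // -det; ring.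
- move=> u; rewrite beta vE => uz uv y.
  (* Cramer's rule: [uz] and [uv] form a linear system in [a u], [b u] whose determinant is 1 by
     [det]. *)
  have au : a u = 0.
    rewrite -[a u]mulr1 -det.
    rewrite (_ : _ * _ =
      a y1 * (A * a u + B * b u) - B * (a y1 * b u - b y1 * a u)); last by ring.
    by rewrite uz uv; ring.
  have bu : b u = 0.
    rewrite -[b u]mulr1 -det.
    rewrite (_ : _ * _ =
      b y1 * (A * a u + B * b u) + A * (a y1 * b u - b y1 * a u)); last by ring.
    by rewrite uz uv; ring.
  by rewrite lieE au bu !(mul0r, mulr0) subr0 scale0r.
Qed.

(** After completion, every [q j], and every [p j] with [j >= 2], is orthogonal to [q 0] and [q 1],
    hence central; only the bracket of [p 0] and [p 1] remains. *)
Lemma closed_symplectic_basis (F : fieldType) (g : lieAlgebra F) (n : nat)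
    (e : (2 * n)%N.-tuple g) (w : {biscalar g}) :
  (2 <= n)%N -> heisenberg_sum_basis e -> symplectic_form w ->
  exists x : (2 * n)%N.-tuple g,
    symplectic_basis w x /\ single_bracket_relation x n.
Proof.
move=> n2 [be rel] sw; have [[alt nondeg] _] := sw.
have dimg : \dim {:g} = (2 * n)%N by rewrite -(size_basis be).
have m2 : (2 < 2 * n)%N by lia.
have [p0 [q0 [pq0 lie01 central]]] := closed_nondeg_normal_pairs be rel m2 sw.
have [|p [q [agree pq]]] := symplectic_pairs_complete alt nondeg pq0 n2.
  by rewrite dimg.
exists (tuple_of_pairs n p q); split; first exact: symplectic_pairs_basis.
have [p0E q0E] := agree 0%N isT; have [p1E q1E] := agree 1%N isT.
have [n_gt0 n_gt1] : (0 < n)%N /\ (1 < n)%N by lia.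
have lie_p j : (1 < j < n)%N -> forall y, lie g (p j) y = 0.
  move=> /andP[j1 jn]; apply: central.
    rewrite -q0E; have [_ _ ->] := pq j 0%N jn n_gt0.
    by rewrite gtn_eqF // ltnW.
  by rewrite -q1E; have [_ _ ->] := pq j 1%N jn n_gt1; rewrite gtn_eqF.
have lie_q j : (j < n)%N -> forall y, lie g (q j) y = 0.
  move=> jn; apply: central.
    by rewrite -q0E; have [_ -> _] := pq j 0%N jn n_gt0.
  by rewrite -q1E; have [_ -> _] := pq j 1%N jn n_gt1.
have skew y z : lie g z y = 0 -> lie g y z = 0.
  by move=> zy; rewrite (alternating_skew (@lie_alternating F g)) zy oppr0.
move=> i j ij; have [lti ltj] := (ltn_ord i, ltn_ord j).
have lt_n : (n < 2 * n)%N by lia.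
(* Position [n] opens the second half, so the prescribed bracket value is [q 0], rewritten here as
   the bracket of [p 0] and [p 1]. *)
rewrite !nth_tuple_of_pairs // ltnn subnn q0E -lie01 -p0E -p1E.
have [ltjn|lejn] := ltnP j n; last first.
  have -> : (i == 0%N :> nat) && (j == 1%N :> nat) = false by lia.
  by apply: skew; apply: lie_q; lia.
have -> : (i < n)%N by lia.
have [j1|j1] := ltnP 1 j.
  have -> : (i == 0%N :> nat) && (j == 1%N :> nat) = false by lia.
  by apply: skew; apply: lie_p; lia.
by have [-> ->] : i = 0%N :> nat /\ j = 1%N :> nat by lia.
Qed.

(** * Uniqueness up to automorphism *)

Lemma alternating_eq_basis (F : fieldType) (V : vectType F)
    (w1 w2 : {biscalar V}) (alt1 : forall x, w1 x x = 0)
    (alt2 : forall x, w2 x x = 0) (m : nat) (x y : m.-tuple V) :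
  (forall i j : 'I_m, (i < j)%N -> w1 x`_i x`_j = w2 y`_i y`_j) ->
  forall i j : 'I_m, w1 x`_i x`_j = w2 y`_i y`_j.
Proof.
move=> h i j; have [ij|ji|ij] := ltngtP i j; first exact: h.
  by rewrite (alternating_skew alt1) (alternating_skew alt2) h.
by rewrite ij alt1 alt2.
Qed.

(** The linear map sending [y] to [x] preserves brackets because both bases have the same structure
    constants, and it pulls [w1] back to [w2] with scale 1. *)
Lemma equiv_of_bases (F : fieldType) (g : lieAlgebra F) (m k : nat)
    (m2 : (2 <= m)%N) (km : (k < m)%N) (w1 w2 : {biscalar g})
    (x y : m.-tuple g) (bx : basis_of fullv x) (yb : basis_of fullv y)
    (relx : single_bracket_relation x k) (rely : single_bracket_relation y k) :
  (forall i j : 'I_m, w1 x`_i x`_j = w2 y`_i y`_j) -> equiv_aut_scale w1 w2.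
Proof.
move=> wE; have [h0 h1] : (0 < m)%N /\ (1 < m)%N by lia.
pose i0 := Ordinal h0; pose i1 := Ordinal h1; pose ik := Ordinal km.
have [f fE] := linear_of_free y x; have [f' f'E] := linear_of_free x y.
have fy (i : 'I_m) : f y`_i = x`_i.
  by rewrite -fE ?(basis_free yb) ?size_tuple // (nth_map 0) ?size_tuple.
have fx (i : 'I_m) : f' x`_i = y`_i.
  by rewrite -f'E ?(basis_free bx) ?size_tuple // (nth_map 0) ?size_tuple.
have fsum u : f u = \sum_i coord y i u *: x`_i.
  rewrite {1}(coord_basis yb (memvf u)) linear_sum.
  by apply: eq_bigr => i _; rewrite linearZ fy.
have coordf i u : coord x i (f u) = coord y i u.
  by rewrite fsum coord_sum_free // (basis_free bx).
exists (linfun f), 1; split; rewrite ?oner_eq0 //.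
  split; first exists f'.
  - move=> u; rewrite lfunE /= fsum linear_sum.
    rewrite [RHS](coord_basis yb (memvf u)).
    by apply: eq_bigr => i _; rewrite linearZ fx.
  - move=> u; rewrite lfunE /= [in LHS](coord_basis bx (memvf u)) !linear_sum.
    rewrite [RHS](coord_basis bx (memvf u)).
    by apply: eq_bigr => i _; rewrite !linearZ /= fx fy.
  - move=> u v; rewrite !lfunE /=.
    rewrite (lie_coordE (i0:=i0) (i1:=i1) yb _ _ _ _ rely) //.
    rewrite (lie_coordE (i0:=i0) (i1:=i1) bx _ _ _ _ relx) // !coordf.
    by rewrite linearZ -[k]/(val ik) fy.
move=> u v; rewrite mul1r !lfunE /= !fsum.
rewrite [in RHS](coord_basis yb (memvf u)) [in RHS](coord_basis yb (memvf v)).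
rewrite !linear_sumlz; apply: eq_bigr => i _; rewrite !linear_sumr.
by apply: eq_bigr => j _; rewrite !linearZl_LR !linearZr_LR /= wE.
Qed.

(** * Existence of a symplectic structure *)

(* Pairs e_i with e_{2n+1-i}, so the central vector e_{2n} is dual to e_1. *)
Definition antidiagonal_form (F : fieldType) (V : vectType F) (n : nat)
    (e : (2 * n)%N.-tuple V) (u v : V) : F :=
  \sum_(i < 2 * n)
    (-1) ^+ (n <= i)%N * coord e i u * coord e (rev_ord i) v.

Fact antidiagonal_form_bilinear (F : fieldType) (V : vectType F) (n : nat)
    (e : (2 * n)%N.-tuple V) : bilinear_for
  (GRing.Scale.Law.clone _ _ *%R _) (GRing.Scale.Law.clone _ _ *%R _)
  (antidiagonal_form e).
Proof.
split=> [u'|u] k x y /=; rewrite /antidiagonal_form mulr_sumr -big_split /=;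
  apply: eq_bigr => i _; rewrite linearD linearZ /=; ring.
Qed.

HB.instance Definition _ (F : fieldType) (V : vectType F) (n : nat)
    (e : (2 * n)%N.-tuple V) :=
  bilinear_isBilinear.Build F V V F _ _ (antidiagonal_form e)
    (antidiagonal_form_bilinear e).

Lemma antidiagonal_form_alternating (F : fieldType) (V : vectType F) (n : nat)
    (e : (2 * n)%N.-tuple V) (u : V) : antidiagonal_form e u u = 0.
Proof.
(* Index reversal swaps the two halves of the sum up to sign. *)
rewrite /antidiagonal_form (bigID (fun i : 'I_(2 * n) => (i < n)%N)) /=.
rewrite [X in _ + X](reindex_inj rev_ord_inj) /=.
rewrite [X in _ + X](eq_bigl (fun i : 'I_(2 * n) => (i < n)%N)); last first.
  by move=> i /=; have := ltn_ord i; lia.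
rewrite -big_split big1 //= => i lt_in; rewrite rev_ordK.
have -> : (n <= i)%N = false by lia.
have -> : (n <= 2 * n - i.+1)%N by lia.
by rewrite expr0 expr1; ring.
Qed.

(** Reading off coordinates gives nondegeneracy, and the case [i = 0] identifies the pairing with
    the central vector. *)
Lemma antidiagonal_form_basis (F : fieldType) (V : vectType F) (n : nat)
    (e : (2 * n)%N.-tuple V) (u : V) (i : 'I_(2 * n)) : free e ->
  antidiagonal_form e u e`_(rev_ord i) = (-1) ^+ (n <= i)%N * coord e i u.
Proof.
move=> fe; rewrite /antidiagonal_form (bigD1 i) //= big1 ?addr0 => [|j ji].
  by rewrite -[(_ - _)%N]/(val (rev_ord i)) coord_free // eqxx mulr1.
rewrite -[(_ - _)%N]/(val (rev_ord i)) coord_free //.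
by rewrite (inj_eq rev_ord_inj) eq_sym (negPf ji) mulr0.
Qed.

Lemma antidiagonal_form_symplectic (F : fieldType) (g : lieAlgebra F) (n : nat)
    (e : (2 * n)%N.-tuple g) : (2 <= n)%N -> heisenberg_sum_basis e ->
  symplectic_form (antidiagonal_form e).
Proof.
move=> n2 [be rel]; have fe := basis_free be.
split; first split; first exact: antidiagonal_form_alternating.
  move=> u u0; rewrite (coord_basis be (memvf u)) big1 // => i _.
  have /eqP : antidiagonal_form e u e`_(rev_ord i) = 0 by apply: u0.
  rewrite antidiagonal_form_basis // mulf_eq0 signr_eq0 => /eqP->.
  exact: scale0r.
have [h0 h1] : (0 < 2 * n)%N /\ (1 < 2 * n)%N by lia.
pose i0 := Ordinal h0; pose i1 := Ordinal h1.
apply: (closed_of_bracket (a := coord e i0) (b := coord e i1) (c := 1)).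
  by move=> u v; apply: (lie_coordE (k := (2 * n).-1) be).
(* [2 * n - 1] is the value of [rev_ord i0]; the sign is trivial since [n <= 0] fails. *)
move=> u; rewrite -subn1.
rewrite [LHS](antidiagonal_form_basis u i0 fe) leqn0 gtn_eqF ?expr0 //; lia.
Qed.

(** * The converse direction and the classification *)

(** Only x_1 pairs nontrivially with x_{n+1}, so [w] paired with the central vector is [t^-1] times
    the first coordinate functional. *)
Lemma closed_of_symplectic_basis (F : fieldType) (g : lieAlgebra F) (n : nat)
    (n2 : (2 <= n)%N) (w : {biscalar g}) (alt : forall x, w x x = 0) (t : F)
    (x : (2 * n)%N.-tuple g) : t != 0 ->
  symplectic_basis (fun u v => t * w u v) x -> single_bracket_relation x n ->
  closed_form w.
Proof.
move=> t0 [bx wx] rel.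
have [h0 h1] : (0 < 2 * n)%N /\ (1 < 2 * n)%N by lia.
have hn : (n < 2 * n)%N by lia.
pose i0 := Ordinal h0; pose i1 := Ordinal h1; pose j := Ordinal hn.
apply: (closed_of_bracket (a := coord x i0) (b := coord x i1) (c := t^-1)).
  by move=> u v; apply: (lie_coordE (k := n) bx).
move=> u; apply: (mulfI t0); rewrite mulVKf //.
rewrite {1}(coord_basis bx (memvf u)) linear_sumlz mulr_sumr.
rewrite (bigD1 i0) //= big1 ?addr0 => [|i].
  rewrite linearZl_LR /= mulrCA (_ : t * _ = 1) ?mulr1 //.
  by rewrite (wx i0 j) //= ?eqxx //; lia.
rewrite -val_eqE /= => i_neq0; rewrite linearZl_LR /= mulrCA.
rewrite (_ : t * _ = 0) ?mulr0 //; have [ij|ji|ij] := ltngtP i n.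
- by rewrite (wx i j) //= (_ : (_ == _) = false) //; lia.
(* The partner of position [n] in this order would be position [n + n], which is out of range. *)
- rewrite (alternating_skew alt) mulrN (wx j i) //=.
  by rewrite (_ : (_ == _) = false) ?oppr0 //; have := ltn_ord i; lia.
- by rewrite ij alt mulr0.
Qed.

Theorem corollary5p8 (R : realType) (n : nat) (hn : (2 <= n)%N)
    (g : lieAlgebra R) (e : (2 * n)%N.-tuple g)
    (he : heisenberg_sum_basis e) :
  [/\ exists w : {biscalar g}, symplectic_form w,
      forall w1 w2 : {biscalar g},
        symplectic_form w1 -> symplectic_form w2 -> equiv_aut_scale w1 w2
    & forall w : {biscalar g}, nondeg_two_form w ->
        (closed_form w <->
         exists (t : R) (x : (2 * n)%N.-tuple g),
           [/\ 0 < t,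
               symplectic_basis (fun u v => t * w u v) x
             & single_bracket_relation x n])].
Proof.
split.
- by exists (antidiagonal_form e); apply: antidiagonal_form_symplectic.
- move=> w1 w2 sw1 sw2.
  have [x [[bx wx] relx]] := closed_symplectic_basis hn he sw1.
  have [y [[yb wy] rely]] := closed_symplectic_basis hn he sw2.
  have [m2 nm] : (2 <= 2 * n)%N /\ (n < 2 * n)%N by lia.
  (* Each basis is symplectic for its own form and both satisfy the same bracket relation. *)
  apply: (equiv_of_bases m2 nm bx yb relx rely).
  apply: (alternating_eq_basis sw1.1.1 sw2.1.1) => i j ij.
  by rewrite wx // wy.
- move=> w nw; split=> [cw|[t [x [t0 sx rel]]]]; last first.
    by apply: closed_of_symplectic_basis sx rel; rewrite ?gt_eqF //; case: nw.
  have [x [[bx wx] rel]] := closed_symplectic_basis hn he (conj nw cw).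
  exists 1, x; split=> //.
  by split=> // i j ij; rewrite mul1r wx.
Qed.
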